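(* Let $\ell^{OI}$ be a line in a Desargues affine plane, with its skew field structure $(\ell^{OI},+,\cdot)$ given by addition and multiplication of points. Let $A,B,C\in\ell^{OI}$ be three fixed, pairwise different points, each different from $O$. For $X\in\ell^{OI}$ put $f_D(X)=c_r(A,B;C,X)=[(A-X)^{-1}(B-X)][(B-C)^{-1}(A-C)]$ and let $\mathcal{R}^{D}_4=\{f_D(X)\mid X\in\ell^{OI}\}$. Then the elements $f_D(\cdot)$ of $\mathcal{R}^{D}_4$, with addition of points, satisfy: (1) associativity: $[f_D(X)+f_D(Y)]+f_D(Z)=f_D(X)+[f_D(Y)+f_D(Z)]$ for all $X,Y,Z\in\ell^{OI}$; (2) commutativity: $f_D(X)+f_D(Y)=f_D(Y)+f_D(X)$ for all $X,Y\in\ell^{OI}$; (3) existence of a neutral (zero) element: there is $Z\in\ell^{OI}$ such that $f_D(X)+f_D(Z)=f_D(X)$ for all $X\in\ell^{OI}$.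
   Context: A Desargues affine plane is an affine plane (two distinct points lie on exactly one line; through a point $P$ not on a line $\ell$ passes exactly one line disjoint from $\ell$; there are three non-collinear points) satisfying Desargues' axiom: if $\ell^{AA'},\ell^{BB'},\ell^{CC'},\ell^{AC},\ell^{A'C'}$ are pairwise distinct lines such that $\ell^{AA'},\ell^{BB'},\ell^{CC'}$ are all parallel or all meet in one point $P$, and if $\ell^{AB}\parallel\ell^{A'B'}$, $\ell^{BC}\parallel\ell^{B'C'}$, $A\ne C$, $A'\ne C'$, $\ell^{AB}\ne\ell^{A'B'}$, $\ell^{BC}\ne\ell^{B'C'}$, then $\ell^{AC}\parallel\ell^{A'C'}$. Here $\ell^{PQ}$ is the line through $P,Q$, and $\ell^{R}_{PQ}$ is the line through $R$ parallel to $\ell^{PQ}$. Fix a line $\ell^{OI}$ through two distinct points $O,I$. For $A,B\in\ell^{OI}$ and an auxiliary point $B_1\notin\ell^{OI}$: addition: $P_1=\ell^{B_1}_{OI}\cap\ell^{A}_{OB_1}$ and $A+B=\ell^{P_1}_{BB_1}\cap\ell^{OI}$; multiplication: $P_1=\ell^{A}_{IB_1}\cap\ell^{OB_1}$ and $A\cdot B=\ell^{P_1}_{BB_1}\cap\ell^{OI}$. It is known that $(\ell^{OI},+,\cdot)$ is a skew field (division ring) with zero $O$ and unit $I$. Cross-ratio: for four points $A,B,C,D\in\ell^{OI}$, no three of them equal, $c_r(A,B;C,D)=[(A-D)^{-1}(B-D)][(B-C)^{-1}(A-C)]$, computed in this skew field. The paper writes the cross-ratio for all $X\in\ell^{OI}$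 and gives no separate convention for a value of $X$ at which an inverse of $O$ would occur. The subscript $D$ in $f_D$ and superscript $D$ in $\mathcal{R}^{D}_4$ only indicate which of the four positions is variable. *)

(* Defs.v *)
From Stdlib Require Import List Classical ClassicalEpsilon.
Import ListNotations.

Set Implicit Arguments.

Record affine_plane := AffinePlane {
  point : Type;
  line : Type;
  on : point -> line -> Prop;
  line_through_ex : forall P Q, P <> Q -> exists! l, on P l /\ on Q l;
  disjoint_line_ex : forall P l, ~ on P l ->
    exists! m, on P m /\ ~ (exists Q, on Q l /\ on Q m);
  three_points_ex : exists P Q R, P <> Q /\ Q <> R /\ P <> R /\
    ~ (exists l, on P l /\ on Q l /\ on R l)
}.

Arguments on {_} _ _.

Lemma inhabited_point (Pi : affine_plane) : inhabited (point Pi).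
Proof. destruct (three_points_ex Pi) as [P _]. exact (inhabits P). Qed.

Lemma inhabited_line (Pi : affine_plane) : inhabited (line Pi).
Proof.
destruct (three_points_ex Pi) as [P [Q [_ [PQ _]]]].
destruct (@line_through_ex Pi P Q PQ) as [l _]. exact (inhabits l).
Qed.

(* Definite descriptions; the value is unspecified when nothing satisfies S. *)
Definition the_point {Pi : affine_plane} (S : point Pi -> Prop) : point Pi :=
  epsilon (inhabited_point Pi) S.

Definition the_line {Pi : affine_plane} (S : line Pi -> Prop) : line Pi :=
  epsilon (inhabited_line Pi) S.

Definition parallel {Pi : affine_plane} (l m : line Pi) : Prop :=
  l = m \/ ~ (exists P, on P l /\ on P m).

(* Meaningful for P <> Q. *)
Definition join {Pi : affine_plane} (P Q : point Pi) : line Pi :=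
  the_line (fun l => on P l /\ on Q l).

Definition parallel_at {Pi : affine_plane} (R : point Pi) (l : line Pi)
  : line Pi :=
  the_line (fun m => on R m /\ parallel l m).

(* Meaningful for non-parallel l and m. *)
Definition meet {Pi : affine_plane} (l m : line Pi) : point Pi :=
  the_point (fun P => on P l /\ on P m).

(* The inequalities in the first two rows are those needed for the joins to
   denote lines; A <> C and A' <> C' are among them. *)
Definition desargues (Pi : affine_plane) : Prop :=
  forall A B C A' B' C' : point Pi,
    A <> A' -> B <> B' -> C <> C' ->
    A <> B -> A' <> B' -> B <> C -> B' <> C' -> A <> C -> A' <> C' ->
    NoDup [join A A'; join B B'; join C C'; join A C; join A' C'] ->
    (parallel (join A A') (join B B') /\ parallel (join B B') (join C C') /\
       parallel (join A A') (join C C')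
     \/ exists P, on P (join A A') /\ on P (join B B') /\ on P (join C C')) ->
    parallel (join A B) (join A' B') ->
    parallel (join B C) (join B' C') ->
    join A B <> join A' B' ->
    join B C <> join B' C' ->
    parallel (join A C) (join A' C').

(* The constructions of A + B and A * B on the line OI from the auxiliary
   point B1, which has to lie off that line. *)
Definition add_via {Pi : affine_plane} (O I B1 A B : point Pi) : point Pi :=
  let P1 := meet (parallel_at B1 (join O I)) (parallel_at A (join O B1)) in
  meet (parallel_at P1 (join B B1)) (join O I).

Definition mul_via {Pi : affine_plane} (O I B1 A B : point Pi) : point Pi :=
  let P1 := meet (parallel_at A (join I B1)) (join O B1) in
  meet (parallel_at P1 (join B B1)) (join O I).

(* The sum (product) is the point that the construction yields whichever
   auxiliary point is used. *)
Definition add {Pi : affine_plane} (O I A B : point Pi) : point Pi :=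
  the_point (fun S => forall B1, ~ on B1 (join O I) -> add_via O I B1 A B = S).

Definition mul {Pi : affine_plane} (O I A B : point Pi) : point Pi :=
  the_point (fun S => forall B1, ~ on B1 (join O I) -> mul_via O I B1 A B = S).

Definition opp {Pi : affine_plane} (O I A : point Pi) : point Pi :=
  the_point (fun X => on X (join O I) /\ add O I A X = O /\ add O I X A = O).

Definition sub {Pi : affine_plane} (O I A B : point Pi) : point Pi :=
  add O I A (opp O I B).

(* The inverse in the skew field, made total: O has no inverse there, and the
   parameter v is the value to be read for the inverse of O. *)
Definition inv {Pi : affine_plane} (O I v A : point Pi) : point Pi :=
  if excluded_middle_informative (A = O) then v
  else the_point
    (fun X => on X (join O I) /\ mul O I A X = I /\ mul O I X A = I).

(* [(A - D)^-1 (B - D)] [(B - C)^-1 (A - C)] *)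
Definition cross_ratio {Pi : affine_plane} (O I v A B C D : point Pi)
  : point Pi :=
  mul O I
    (mul O I (inv O I v (sub O I A D)) (sub O I B D))
    (mul O I (inv O I v (sub O I B C)) (sub O I A C)).

(* Main.v *)
From Stdlib Require Import List Classical ClassicalEpsilon.
Require Import Defs.
Import ListNotations.

(* A dilatation is a map s of the plane such that XY is parallel to sX sY; it
   is determined by the images of two points.  Desargues' axiom, for parallel
   and for concurrent lines respectively, provides translations and
   homotheties carrying a point to any given point of its trace; translations
   are built with the help of a third parallel, available because A, B, C give
   every line a third point.  The two constructions on OI are then
   A + B = t(B), with t the translation along OI taking O to A, and
   A * B = h(B), with h the homothety of centre O taking I to A,
   independently of the auxiliary point.  Addition is therefore composition of
   translations, which commute; and all values of the cross ratio lie on OI,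
   with f(B) = O because B - B = O. *)

(** * Incidence and parallelism *)

Section Incidence.

Context {Pi : affine_plane}.
Implicit Types (P Q R X Y A B : point Pi) (l m n d : line Pi).

Lemma line_eq P Q l m :
  P <> Q -> on P l -> on Q l -> on P m -> on Q m -> l = m.
Proof.
intros PQ Pl Ql Pm Qm.
destruct (line_through_ex Pi PQ) as [k [_ Hk]].
rewrite <- (Hk l), <- (Hk m); auto.
Qed.

Lemma point_eq P Q l m :
  l <> m -> on P l -> on P m -> on Q l -> on Q m -> P = Q.
Proof.
intros lm Pl Pm Ql Qm. apply NNPP; intros PQ. apply lm.
now apply (line_eq P Q).
Qed.

Lemma the_point_spec (S : point Pi -> Prop) : (exists P, S P) -> S (the_point S).
Proof. apply epsilon_spec. Qed.

Lemma the_line_spec (S : line Pi -> Prop) : (exists l, S l) -> S (the_line S).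
Proof. apply epsilon_spec. Qed.

Lemma join_on P Q : P <> Q -> on P (join P Q) /\ on Q (join P Q).
Proof.
intros PQ. apply (the_line_spec (fun l => on P l /\ on Q l)).
destruct (line_through_ex Pi PQ) as [k [Hk _]]. now exists k.
Qed.

Lemma join_on_l P Q : P <> Q -> on P (join P Q).
Proof. apply join_on. Qed.

Lemma join_on_r P Q : P <> Q -> on Q (join P Q).
Proof. apply join_on. Qed.

Lemma join_eq P Q l : P <> Q -> on P l -> on Q l -> join P Q = l.
Proof.
intros PQ Pl Ql. apply (line_eq P Q); auto using join_on_l, join_on_r.
Qed.

Lemma off_line l : exists P, ~ on P l.
Proof.
destruct (three_points_ex Pi) as [P [Q [R [_ [_ [_ H]]]]]].
apply NNPP; intros N. apply H. exists l.
repeat split; apply NNPP; intros K; apply N; eauto.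
Qed.

Lemma par_sym l m : parallel l m -> parallel m l.
Proof.
intros [->|H]; [now left|right]. intros [P []]; apply H; eauto.
Qed.

Lemma par_on_eq l m P : parallel l m -> on P l -> on P m -> l = m.
Proof. intros [->|H] Pl Pm; trivial. exfalso; eauto. Qed.

(** If [l] and [n] share a point off [m], both are the unique line through it disjoint from [m]. *)
Lemma par_trans l m n : parallel l m -> parallel m n -> parallel l n.
Proof.
intros lm mn. destruct (classic (exists P, on P l /\ on P n)) as [[P [Pl Pn]]|H];
  [left|now right].
destruct (classic (on P m)) as [Pm|Pm].
- now rewrite (par_on_eq l m P), (par_on_eq m n P).
- destruct lm as [->|lm]; [contradiction|].
  destruct mn as [<-|mn]; [contradiction|].
  destruct (disjoint_line_ex Pi P m Pm) as [k [_ Hk]].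
  rewrite <- (Hk l), <- (Hk n); trivial; split; trivial.
  intros [Q []]; eauto.
Qed.

Lemma parallel_at_spec P l :
  on P (parallel_at P l) /\ parallel l (parallel_at P l).
Proof.
apply (the_line_spec (fun m => on P m /\ parallel l m)).
destruct (classic (on P l)) as [Pl|Pl].
- exists l; split; trivial; now left.
- destruct (disjoint_line_ex Pi P l Pl) as [k [[Pk Hk] _]].
  exists k; split; trivial; now right.
Qed.

Lemma parallel_at_on P l : on P (parallel_at P l).
Proof. apply parallel_at_spec. Qed.

Lemma parallel_at_par P l : parallel l (parallel_at P l).
Proof. apply parallel_at_spec. Qed.

Lemma parallel_at_unique P l m :
  on P m -> parallel l m -> parallel_at P l = m.
Proof.
intros Pm lm. apply (par_on_eq _ _ P); auto using parallel_at_on.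
apply par_trans with l; auto using par_sym, parallel_at_par.
Qed.

Lemma parallel_at_self P l : on P l -> parallel_at P l = l.
Proof. intros Pl. apply parallel_at_unique; trivial. now left. Qed.

Lemma parallel_at_congr P l m :
  parallel l m -> parallel_at P l = parallel_at P m.
Proof.
intros lm. apply parallel_at_unique; auto using parallel_at_on.
apply par_trans with m; auto using parallel_at_par.
Qed.

Lemma parallel_at_same P Q l :
  on Q (parallel_at P l) -> parallel_at Q l = parallel_at P l.
Proof. intros H. apply parallel_at_unique; auto using parallel_at_par. Qed.

Lemma parallel_at_eq_par P Q l m :
  parallel_at P l = parallel_at Q m -> parallel l m.
Proof.
intros H. apply par_trans with (parallel_at P l); auto using parallel_at_par.
rewrite H. auto using par_sym, parallel_at_par.
Qed.

Lemma meet_eq P l m : l <> m -> on P l -> on P m -> meet l m = P.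
Proof.
intros lm Pl Pm.
destruct (the_point_spec (fun P => on P l /\ on P m)) as [Hl Hm]; [eauto|].
now apply (point_eq _ _ l m).
Qed.

Lemma not_par_meet l m : ~ parallel l m -> exists P, on P l /\ on P m.
Proof. intros H. apply NNPP; intros N. apply H. now right. Qed.

(** Rules out the plane of order two, where a parallel class has only two lines. *)
Definition three_on l :=
  exists P Q R, on P l /\ on Q l /\ on R l /\ P <> Q /\ Q <> R /\ P <> R.

(** Parallel projection between two lines, in a direction different from both, is injective, so it
    carries three points of [l] to three points of the other line. *)
Lemma three_on_join l X Y : three_on l -> X <> Y -> three_on (join X Y).
Proof.
intros [U [V [W [Ul [Vl [Wl [UV [VW UW]]]]]]]] XY.
set (m := join X Y).
destruct (classic (l = m)) as [<-|lm]; [exists U, V, W; tauto|].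
assert (HP : exists P, on P l /\ ~ on P m).
{ destruct (classic (on U m)); [exists V|exists U]; split; trivial.
  intros Vm. apply lm. now apply (line_eq U V). }
assert (HQ : exists Q, on Q m /\ ~ on Q l).
{ destruct (classic (on X l)) as [Xl|]; [exists Y|exists X]; split; trivial;
    try now apply join_on.
  intros Yl. apply lm. symmetry. now apply join_eq. }
destruct HP as [P [Pl Pm]], HQ as [Q [Qm Ql]].
assert (PQ : P <> Q) by congruence.
(* Project l onto m along PQ. *)
set (d := join P Q).
assert (Pd : on P d) by now apply join_on_l.
assert (Qd : on Q d) by now apply join_on_r.
assert (proj : forall Z, exists Z', on Z' (parallel_at Z d) /\ on Z' m).
{ intros Z. apply not_par_meet. intros H.
  assert (dm : d = m).
  { apply (par_on_eq _ _ Q); trivial.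
    apply par_trans with (parallel_at Z d); auto using parallel_at_par. }
  apply Pm. now rewrite <- dm. }
assert (inj : forall Z1 Z2 Z', on Z1 l -> on Z2 l -> Z1 <> Z2 ->
  on Z' (parallel_at Z1 d) -> on Z' (parallel_at Z2 d) -> False).
{ intros Z1 Z2 Z' H1 H2 N K1 K2. apply Ql.
  assert (E : parallel_at Z1 d = parallel_at Z2 d).
  { now rewrite <- (parallel_at_same _ _ _ K1), <- (parallel_at_same _ _ _ K2). }
  assert (dl : d = l).
  { apply (par_on_eq _ _ P); trivial.
    rewrite <- (line_eq Z1 Z2 (parallel_at Z1 d) l);
      auto using parallel_at_on, parallel_at_par.
    rewrite E; apply parallel_at_on. }
  now rewrite <- dl. }
destruct (proj U) as [U' [? ?]], (proj V) as [V' [? ?]], (proj W) as [W' [? ?]].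
exists U', V', W'; repeat split; trivial; intros ->; eauto.
Qed.

Lemma join_third l X Y : three_on l -> X <> Y ->
  exists Z, on Z (join X Y) /\ Z <> X /\ Z <> Y.
Proof.
intros H XY.
destruct (three_on_join _ X Y H XY) as [U [V [W [? [? [? [? [? ?]]]]]]]].
apply NNPP; intros N.
assert (K : forall Z, on Z (join X Y) -> Z = X \/ Z = Y).
{ intros Z HZ. apply NNPP; intros NZ. apply N. exists Z. tauto. }
destruct (K U), (K V), (K W); congruence.
Qed.

End Incidence.

(** * Dilatations and their determination by two images *)

Section Dilatations.

Context {Pi : affine_plane}.
Implicit Types (P Q R X Y A B : point Pi) (l m n d e : line Pi)
  (s t : point Pi -> point Pi).

(* XY is parallel to X'Y'; holds when X' = Y', and forces it when X = Y. *)
Definition pll X Y X' Y' :=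
  forall l, on X l -> on Y l -> on Y' (parallel_at X' l).

Lemma pll_sym X Y X' Y' : pll X Y X' Y' -> pll Y X Y' X'.
Proof.
intros H l Yl Xl. rewrite (parallel_at_same X' Y' l); auto.
apply parallel_at_on.
Qed.

Lemma pll_refl X Y : pll X Y X Y.
Proof. intros l Xl Yl. now rewrite parallel_at_self. Qed.

Lemma pll_par X Y X' Y' : X <> Y -> X' <> Y' ->
  pll X Y X' Y' <-> parallel (join X Y) (join X' Y').
Proof.
intros XY XY'. split.
- intros H. rewrite (join_eq X' Y' (parallel_at X' (join X Y)));
    auto using parallel_at_par, parallel_at_on.
  apply H; now apply join_on.
- intros H l Xl Yl. rewrite <- (join_eq X Y l); trivial.
  rewrite (parallel_at_unique X' _ (join X' Y')); trivial; now apply join_on.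
Qed.

(** Constant maps qualify, since [pll] holds when the images coincide; this later covers
    multiplication by [O]. *)
Definition dilatation s := forall X Y, pll X Y (s X) (s Y).

Lemma dilatation_comp s t :
  dilatation s -> dilatation t -> dilatation (fun X => s (t X)).
Proof.
intros Hs Ht X Y l Xl Yl.
rewrite (parallel_at_congr _ _ (parallel_at (t X) l));
  auto using parallel_at_par.
apply Hs; auto using parallel_at_on. now apply Ht.
Qed.

(** The image of [X] is the intersection of the parallels to [join P X] and [join Q X] through the
    images of [P] and [Q]. *)
Lemma dilatation_eq_off s t P Q X :
  dilatation s -> dilatation t -> P <> Q -> s P = t P -> s Q = t Q ->
  ~ on X (join P Q) -> s X = t X.
Proof.
intros Hs Ht PQ EP EQ HX.
destruct (join_on P Q PQ) as [HP HQ].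
assert (PX : P <> X) by congruence. assert (QX : Q <> X) by congruence.
destruct (join_on P X PX), (join_on Q X QX).
apply (point_eq _ _ (parallel_at (s P) (join P X))
  (parallel_at (s Q) (join Q X))).
- intros E. apply parallel_at_eq_par in E.
  apply (par_on_eq _ _ X) in E; trivial.
  apply HX. rewrite (join_eq P Q (join P X)); trivial. now rewrite E.
- now apply Hs.
- now apply Hs.
- rewrite EP. now apply Ht.
- rewrite EQ. now apply Ht.
Qed.

Lemma dilatation_eq s t P Q :
  dilatation s -> dilatation t -> P <> Q -> s P = t P -> s Q = t Q ->
  forall X, s X = t X.
Proof.
intros Hs Ht PQ EP EQ X.
destruct (classic (on X (join P Q))) as [HX|HX];
  [|now apply (dilatation_eq_off s t P Q)].
destruct (classic (X = P)) as [->|XP]; trivial.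
(* [Z] replaces [Q] as reference point, so that [X] is off the reference line. *)
destruct (off_line (join P Q)) as [Z HZ].
assert (ZP : P <> Z) by (intros <-; apply HZ; now apply join_on_l).
apply (dilatation_eq_off s t P Z); trivial.
- now apply (dilatation_eq_off s t P Q).
- intros K. apply HZ. destruct (join_on P Z ZP), (join_on P Q PQ).
  now rewrite (line_eq P X (join P Q) (join P Z)) by auto.
Qed.

(* Common framework for the parallels to a fixed line (every point is good)
   and the lines through a fixed point (every other point is good); tr X is
   the line of the pencil through the good point X. *)
Record pencil (good : point Pi -> Prop) (tr : point Pi -> line Pi) : Prop := {
  tr_on : forall X, good X -> on X (tr X);
  tr_eq : forall X Y, good X -> good Y -> on Y (tr X) -> tr Y = tr X;
  bad_on_tr : forall X Y, ~ good X -> good Y -> on X (tr Y);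
  bad_unique : forall X Y, ~ good X -> ~ good Y -> X = Y;
  tr_kind : (forall X Y, good X -> good Y -> parallel (tr X) (tr Y)) \/
    (exists P, forall X, good X -> on P (tr X));
  tr_third : forall X Y, good X -> good Y ->
    exists Z, good Z /\ tr Z <> tr X /\ tr Z <> tr Y
}.

(** * Dilatations from Desargues' axiom on a pencil *)

Section Pencil.

Variables (good : point Pi -> Prop) (tr : point Pi -> line Pi).
Hypothesis HP : pencil good tr.

Let on_tr := tr_on _ _ HP.
Let bad_tr := bad_on_tr _ _ HP.

Lemma tr_disjoint X Y A :
  good X -> good Y -> good A -> on A (tr X) -> tr X <> tr Y -> ~ on A (tr Y).
Proof.
intros gX gY gA H N K. apply N.
now rewrite <- (tr_eq _ _ HP X A), <- (tr_eq _ _ HP Y A).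
Qed.

Lemma tr_neq X Y A B : good X -> good Y -> good A -> good B ->
  on A (tr X) -> on B (tr Y) -> tr X <> tr Y -> A <> B.
Proof. intros gX gY gA gB HA HB N ->. now apply (tr_disjoint X Y B). Qed.

(** Since [X] is off [tr Y], the line [join X Y] is not parallel to [tr Y], and the parallel to it
    through [X'] meets [tr Y] at most once. *)
Lemma pll_unique X Y X' U V : good X -> good Y -> tr X <> tr Y ->
  on U (tr Y) -> on V (tr Y) -> pll X Y X' U -> pll X Y X' V -> U = V.
Proof.
intros gX gY N HU HV KU KV.
assert (XY : X <> Y) by congruence.
destruct (join_on X Y XY) as [HX HY].
apply (point_eq _ _ (tr Y) (parallel_at X' (join X Y))); auto.
intros E. apply (tr_disjoint X Y X); auto using on_tr.
rewrite <- (par_on_eq (join X Y) (tr Y) Y); trivial.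
- rewrite E. apply parallel_at_par.
- now apply on_tr.
Qed.

Lemma pll_exists X Y X' : good X -> good Y -> good X' -> on X' (tr X) ->
  tr X <> tr Y -> exists Y', good Y' /\ on Y' (tr Y) /\ pll X Y X' Y'.
Proof.
intros gX gY gX' HX' N.
assert (XY : X <> Y) by congruence.
destruct (join_on X Y XY) as [HX HY].
destruct (not_par_meet (parallel_at X' (join X Y)) (tr Y)) as [Y' [H1 H2]].
{ intros H. apply (tr_disjoint X Y X); auto using on_tr.
  rewrite <- (par_on_eq (join X Y) (tr Y) Y); trivial.
  - eauto using par_trans, parallel_at_par.
  - now apply on_tr. }
exists Y'; repeat split; trivial.
(* A bad [Y'] would lie on [tr X] too, so the parallel through [X'] would be [tr X] itself, forcing
   [Y] onto [tr X]. *)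
- apply NNPP; intros bad.
  apply (tr_disjoint Y X Y); auto using on_tr.
  rewrite <- (par_on_eq (join X Y) (tr X) X); trivial.
  + rewrite (line_eq X' Y' (tr X) (parallel_at X' (join X Y)));
      auto using parallel_at_par, parallel_at_on.
    congruence.
  + now apply on_tr.
- intros l Xl Yl. now rewrite <- (join_eq X Y l).
Qed.

Lemma pll_fixed X Y Y' : good X -> good Y -> on Y' (tr Y) -> tr X <> tr Y ->
  pll X Y X Y' -> Y' = Y.
Proof.
intros gX gY HY' N H.
apply (pll_unique X Y X); auto using pll_refl, on_tr.
Qed.

Lemma pll_same_tr X Y X' Y' : good X -> good Y -> good X' -> tr X = tr Y ->
  on X' (tr X) -> on Y' (tr Y) -> X <> Y -> pll X Y X' Y'.
Proof.
intros gX gY gX' E HX' HY' N l Xl Yl.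
replace l with (tr X).
- rewrite parallel_at_self; trivial. now rewrite E.
- apply (line_eq X Y); auto using on_tr.
  rewrite E. auto using on_tr.
Qed.

(** The axiom demands distinct points and lines. The degenerate cases are split off first: if one
    vertex equals its image, all three do, and the conclusion is trivial. *)
Lemma pencil_desargues A B C A' B' C' : desargues Pi ->
  good A -> good B -> good C -> good A' -> good B' -> good C' ->
  on A' (tr A) -> on B' (tr B) -> on C' (tr C) ->
  tr A <> tr B -> tr B <> tr C -> tr A <> tr C ->
  pll A B A' B' -> pll B C B' C' -> pll A C A' C'.
Proof.
intros HD gA gB gC gA' gB' gC' HA' HB' HC' nAB nBC nAC pAB pBC.
assert (fixB : B' = B -> pll A C A' C').
{ intros ->.
  rewrite (pll_fixed B A A') by auto using pll_sym.
  rewrite (pll_fixed B C C') by auto. apply pll_refl. }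
destruct (classic (B = B')) as [EB|NB]; [auto|].
destruct (classic (A = A')) as [EA|NA].
{ apply fixB, (pll_fixed A); trivial. now rewrite EA at 2. }
destruct (classic (C = C')) as [EC|NC].
{ apply fixB, (pll_fixed C); auto. apply pll_sym. now rewrite EC at 2. }
assert (HA := tr_on _ _ HP A gA). assert (HB := tr_on _ _ HP B gB).
assert (HC := tr_on _ _ HP C gC).
assert (dAB : A <> B) by now apply (tr_neq A B).
assert (dAB' : A' <> B') by now apply (tr_neq A B).
assert (dBC : B <> C) by now apply (tr_neq B C).
assert (dBC' : B' <> C') by now apply (tr_neq B C).
assert (dAC : A <> C) by now apply (tr_neq A C).
assert (dAC' : A' <> C') by now apply (tr_neq A C).
assert (EA : join A A' = tr A) by now apply join_eq.
assert (EB : join B B' = tr B) by now apply join_eq.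
assert (EC : join C C' = tr C) by now apply join_eq.
(* If the lines coincided, they would contain [X] and [X'], hence be [tr X], and [Y] would lie on
   it. *)
assert (differ : forall X Y X' Y', good X -> good Y -> good X' -> X <> X' ->
  X <> Y -> X' <> Y' -> on X' (tr X) -> tr X <> tr Y -> join X Y <> join X' Y').
{ intros X Y X' Y' gX gY gX' n1 n2 n3 H N E.
  apply (tr_disjoint Y X Y); auto using on_tr.
  rewrite <- (line_eq X X' (join X Y) (tr X)); auto using on_tr;
    try now apply join_on.
  rewrite E. now apply join_on. }
assert (not_tr : forall X Y Z, X <> Y -> good X -> good Y -> good Z ->
  tr X <> tr Y -> join X Y <> tr Z).
{ intros X Y Z n gX gY gZ N E. apply N.
  rewrite (tr_eq _ _ HP Z X), (tr_eq _ _ HP Z Y); trivial;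
    rewrite <- E; now apply join_on. }
assert (nAC' : tr A' <> tr C').
{ rewrite (tr_eq _ _ HP A A'), (tr_eq _ _ HP C C'); trivial. }
apply pll_par; trivial.
apply (HD A B C A' B' C'); trivial; try (apply pll_par; trivial);
  try (apply differ; trivial).
- rewrite EA, EB, EC.
  repeat (apply NoDup_cons;
    [simpl; intros K; repeat destruct K as [K|K]; trivial|]);
    try apply NoDup_nil; revert K;
    first [now apply not_eq_sym | now apply not_tr
          | now apply not_eq_sym, differ].
- rewrite EA, EB, EC. destruct (tr_kind _ _ HP) as [H|[P H]]; [left|right]; auto.
  exists P; auto.
Qed.

(** Parallelism with one reference point determines each image; Desargues with middle vertex [R],
    [S] or [T] extends it to all pairs on distinct traces. *)
Lemma pencil_dilatation R R' : desargues Pi ->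
  good R -> good R' -> on R' (tr R) ->
  exists s, dilatation s /\ s R = R' /\
    (forall X, good X -> on (s X) (tr X)) /\ (forall X, ~ good X -> s X = X).
Proof.
intros HD gR gR' HR'.
(* [S] is the reference for points on [tr R]; [T] stands in for it when the other point lies on
   [tr S]. *)
destruct (tr_third _ _ HP R R gR gR) as [S [gS [SR _]]].
destruct (tr_third _ _ HP R S gR gS) as [T [gT [TR TS]]].
destruct (pll_exists R S R') as [S' [gS' [HS' pS]]]; auto.
destruct (pll_exists R T R') as [T' [gT' [HT' pT]]]; auto.
(* Images are constructed from R off its trace and from S on it. *)
assert (ex : forall X, exists X', (~ good X -> X' = X) /\
  (good X -> good X' /\ on X' (tr X) /\ (tr X <> tr R -> pll R X R' X') /\
     (tr X = tr R -> pll S X S' X'))).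
{ intros X. destruct (classic (good X)) as [gX|bX];
    [|exists X; split; [trivial|contradiction]].
  destruct (classic (tr X = tr R)) as [E|N].
  - destruct (pll_exists S X S') as [X' ?]; auto; [congruence|].
    exists X'. tauto.
  - destruct (pll_exists R X R') as [X' ?]; auto. exists X'. tauto. }
set (s := fun X => proj1_sig (constructive_indefinite_description _ (ex X))).
assert (bad : forall X, ~ good X -> s X = X).
{ intros X. unfold s. now destruct constructive_indefinite_description. }
assert (ok : forall X, good X -> good (s X) /\ on (s X) (tr X) /\
  (tr X <> tr R -> pll R X R' (s X)) /\ (tr X = tr R -> pll S X S' (s X))).
{ intros X. unfold s. now destruct constructive_indefinite_description. }
clearbody s.
assert (gs : forall X, good X -> good (s X)) by (intros; now apply ok).
assert (ons : forall X, good X -> on (s X) (tr X)) by (intros; now apply ok).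
assert (offR : forall X X' Y Y', good X -> good Y -> good X' -> good Y' ->
  on X' (tr X) -> on Y' (tr Y) -> tr X <> tr R -> tr Y <> tr R -> tr X <> tr Y ->
  pll R X R' X' -> pll R Y R' Y' -> pll X Y X' Y').
{ intros. apply (pencil_desargues X R Y X' R' Y'); auto using pll_sym. }
assert (offR_S : forall Y, good Y -> tr Y <> tr R -> tr Y <> tr S ->
  pll S Y S' (s Y)).
{ intros Y gY ? ?. apply offR; auto. now apply ok. }
assert (cross : forall X Y, good X -> good Y -> tr X = tr R -> tr Y <> tr R ->
  pll X Y (s X) (s Y)).
{ intros X Y gX gY E N.
  assert (pSX : pll S X S' (s X)) by now apply ok.
  (* On [tr S] the middle vertex is [T], the pair [X], [T] being settled first by way of [S];
     elsewhere it is [S]. *)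
  destruct (classic (tr Y = tr S)) as [ES|NS].
  - apply (pencil_desargues X T Y (s X) T' (s Y)); auto; try congruence.
    + apply (pencil_desargues X S T (s X) S' T'); auto using pll_sym;
        congruence.
    + apply offR; auto; try congruence. now apply ok.
  - apply (pencil_desargues X S Y (s X) S' (s Y)); auto using pll_sym;
      congruence. }
exists s. repeat split; auto.
- intros X Y.
  destruct (classic (X = Y)) as [<-|XY]; [intros l _ _; apply parallel_at_on|].
  destruct (classic (good X)) as [gX|bX], (classic (good Y)) as [gY|bY].
  + destruct (classic (tr X = tr Y)) as [E|N]; [apply pll_same_tr; auto|].
    destruct (classic (tr X = tr R)) as [EX|NX].
    * apply cross; auto; congruence.
    * destruct (classic (tr Y = tr R)) as [EY|NY].
      -- apply pll_sym, cross; auto.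
      -- apply offR; auto; now apply ok.
  (* The line joining [X] to the fixed bad point is [tr X], which contains [s X]. *)
  + rewrite (bad Y bY). intros l Xl Yl.
    rewrite (line_eq X Y l (tr X));
      auto using on_tr, bad_tr.
    rewrite parallel_at_self; auto.
  + apply pll_sym. rewrite (bad X bX). intros l Yl Xl.
    rewrite (line_eq Y X l (tr Y));
      auto using on_tr, bad_tr.
    rewrite parallel_at_self; auto.
  + destruct XY. now apply (bad_unique _ _ HP).
(* Lying on [tr R], the point [R] got its image from [S]; by uniqueness this is [R']. *)
- apply (pll_unique S R S'); auto.
  + now apply ok.
  + now apply pll_sym.
Qed.

End Pencil.

(** * The parallel and the central pencil *)

(** Every point is good. Between two different parallels, a third point of a joining line provides
    the third parallel. *)
Lemma parallel_pencil l d : three_on l ->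
  pencil (fun _ => True) (fun X => parallel_at X d).
Proof.
intros H3. split.
- intros X _. apply parallel_at_on.
- intros X Y _ _. apply parallel_at_same.
- tauto.
- tauto.
- left. intros X Y _ _.
  apply par_trans with d; auto using par_sym, parallel_at_par.
- intros X Y _ _.
  destruct (classic (parallel_at X d = parallel_at Y d)) as [E|N].
  + rewrite <- E. destruct (off_line (parallel_at X d)) as [Z HZ].
    exists Z. enough (parallel_at Z d <> parallel_at X d) by auto.
    intros K. apply HZ. rewrite <- K. apply parallel_at_on.
  + assert (XY : X <> Y) by congruence.
    destruct (join_third l X Y) as [Z [HZ [ZX ZY]]]; trivial.
    destruct (join_on X Y XY) as [HX HY].
    exists Z; repeat split; intros K; apply N.
    * symmetry. apply parallel_at_same.
      rewrite <- (line_eq X Z (join X Y) (parallel_at X d));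
        auto using parallel_at_on.
      rewrite <- K. apply parallel_at_on.
    * apply parallel_at_same.
      rewrite <- (line_eq Y Z (join X Y) (parallel_at Y d));
        auto using parallel_at_on.
      rewrite <- K. apply parallel_at_on.
Qed.

(** The centre is the only bad point. If the lines from [P] to [X] and [Y] differ, a third point of
    [join X Y] lies on neither. *)
Lemma central_pencil l P : three_on l ->
  pencil (fun X => X <> P) (fun X => join P X).
Proof.
intros H3.
assert (same : forall X Y, X <> P -> Y <> P -> on Y (join P X) ->
  join P Y = join P X).
{ intros X Y XP YP H. apply join_eq; auto using join_on_l. }
split; trivial.
- intros X XP. now apply join_on_r, not_eq_sym.
- intros X Y bX YP. apply NNPP in bX; subst X.
  now apply join_on_l, not_eq_sym.
- intros X Y bX bY. apply NNPP in bX, bY. congruence.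
- right. exists P. intros X XP. now apply join_on_l, not_eq_sym.
- intros X Y XP YP.
  assert (aux : exists Z, ~ on Z (join P X) /\ ~ on Z (join P Y)).
  { destruct (classic (join P X = join P Y)) as [E|N].
    - rewrite <- E. destruct (off_line (join P X)) as [Z HZ]. eauto.
    - assert (XY : X <> Y) by congruence.
      destruct (join_third l X Y) as [Z [HZ [ZX ZY]]]; trivial.
      destruct (join_on X Y XY) as [HX HY].
      assert (on X (join P X)) by now apply join_on_r, not_eq_sym.
      assert (on Y (join P Y)) by now apply join_on_r, not_eq_sym.
      exists Z; split; intros K; apply N.
      + symmetry. apply same; trivial.
        now rewrite <- (line_eq X Z (join X Y) (join P X)) by auto.
      + apply same; trivial.
        now rewrite <- (line_eq Y Z (join X Y) (join P Y)) by auto. }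
  destruct aux as [Z [ZX ZY]]. exists Z.
  assert (ZP : Z <> P).
  { intros ->. apply ZX. now apply join_on_l, not_eq_sym. }
  assert (on Z (join P Z)) by now apply join_on_r, not_eq_sym.
  repeat split; trivial; congruence.
Qed.

(** * Translations and homotheties *)

(** Phrased by traces rather than by absence of fixed points, so that the identity is a translation
    in every direction. *)
Definition translation d s :=
  dilatation s /\ forall X, on (s X) (parallel_at X d).

Lemma translation_id d : translation d (fun X => X).
Proof.
split; [intros X Y; apply pll_refl|intros X; apply parallel_at_on].
Qed.

Lemma translation_comp d s t :
  translation d s -> translation d t -> translation d (fun X => s (t X)).
Proof.
intros [Ds Hs] [Dt Ht]. split; [now apply dilatation_comp|].
intros X. rewrite <- (parallel_at_same X (t X) d); auto.
Qed.

(** For [Q] off the trace of [P], the image is forced by the trace of [Q] and the parallel to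
    [join P Q]; two images then suffice. *)
Lemma translation_eq d s t P :
  translation d s -> translation d t -> s P = t P -> forall X, s X = t X.
Proof.
intros [Ds Hs] [Dt Ht] E.
destruct (off_line (parallel_at P d)) as [Q HQ].
assert (PQ : P <> Q) by (intros <-; apply HQ, parallel_at_on).
destruct (join_on P Q PQ).
apply (dilatation_eq s t P Q); trivial.
apply (point_eq _ _ (parallel_at Q d) (parallel_at (s P) (join P Q))); auto.
- intros K. apply parallel_at_eq_par in K. apply HQ.
  now rewrite (parallel_at_unique P d (join P Q)).
- now apply Ds.
- rewrite E. now apply Dt.
Qed.

(** Both sides lie on the parallel to [e] through [s X] and on the parallel to [d] through [t X]. *)
Lemma translation_commute_transverse d e s t :
  translation d s -> translation e t -> ~ parallel d e ->
  forall X, s (t X) = t (s X).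
Proof.
intros [Ds Hs] [Dt Ht] N X.
apply (point_eq _ _ (parallel_at (s X) e) (parallel_at (t X) d)); trivial.
- intros E. apply parallel_at_eq_par in E. now apply N, par_sym.
- rewrite (parallel_at_congr _ _ (parallel_at X e));
    auto using parallel_at_par.
  apply Ds; auto using parallel_at_on.
- rewrite (parallel_at_congr _ _ (parallel_at X d));
    auto using parallel_at_par.
  apply Dt; auto using parallel_at_on.
Qed.

Lemma dilatation_translation s P : dilatation s -> (forall X, s X <> X) ->
  translation (join P (s P)) s.
Proof.
intros Ds N. split; trivial. intros X.
destruct (join_on P (s P)) as [H1 H2]; [now apply not_eq_sym|].
destruct (join_on X (s X)) as [K1 K2]; [now apply not_eq_sym|].
rewrite (parallel_at_unique X _ (join X (s X))); trivial.
(* Two traces of s are stable under s, hence so is their intersection. *)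
apply NNPP; intros H. destruct (not_par_meet _ _ H) as [Q [Q1 Q2]].
apply (N Q). apply (point_eq _ _ (join P (s P)) (join X (s X))); trivial.
- intros E. apply H. now left.
- rewrite <- (parallel_at_self (s P) (join P (s P))) by trivial. now apply Ds.
- rewrite <- (parallel_at_self (s X) (join X (s X))) by trivial. now apply Ds.
Qed.

Lemma translation_exists l d P Q : desargues Pi -> three_on l ->
  on Q (parallel_at P d) -> exists s, translation d s /\ s P = Q.
Proof.
intros HD H3 H.
destruct (pencil_dilatation _ _ (parallel_pencil l d H3) P Q)
  as [s [Ds [E [Hs _]]]]; trivial.
exists s. repeat split; auto.
Qed.

Lemma homothety_exists l O P Q : desargues Pi -> three_on l ->
  P <> O -> Q <> O -> on Q (join O P) ->
  exists s, dilatation s /\ s O = O /\ s P = Q.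
Proof.
intros HD H3 PO QO H.
destruct (pencil_dilatation _ _ (central_pencil l O H3) P Q)
  as [s [Ds [E [_ Hs]]]]; trivial.
exists s. repeat split; auto.
Qed.

(** Reduction to transverse directions: [s] commutes with a transverse [u] and with [t] after [u],
    hence with [t]. *)
Lemma translation_commute l d s t : desargues Pi -> three_on l ->
  translation d s -> translation d t -> forall X, s (t X) = t (s X).
Proof.
intros HD H3 Hs Ht.
destruct (three_points_ex Pi) as [O _].
destruct (off_line (parallel_at O d)) as [Q HQ].
assert (OQ : O <> Q) by (intros <-; apply HQ, parallel_at_on).
set (e := join O Q).
destruct (join_on O Q OQ) as [Oe Qe]; fold e in Oe, Qe.
assert (de : ~ parallel d e).
{ intros H. apply HQ. now rewrite (parallel_at_unique O d e). }
destruct (translation_exists l e O Q) as [u [Hu uO]]; trivial.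
{ now rewrite parallel_at_self. }
(* u is transverse to d, and so is the composite of t with u. *)
assert (Htu : translation (join O (t (u O))) (fun X => t (u X))).
{ apply (dilatation_translation (fun X => t (u X))).
  - apply dilatation_comp; [apply Ht|apply Hu].
  (* A fixed point [X] of the composite would put [u X] on both traces of [X], so [u] would be the
     identity. *)
  - intros X E. apply OQ. rewrite <- uO.
    enough (E' : u X = X).
    { symmetry. now apply (translation_eq e u (fun X => X) X);
        auto using translation_id. }
    apply (point_eq _ _ (parallel_at X e) (parallel_at X d)).
    + intros K. apply parallel_at_eq_par in K. now apply de, par_sym.
    + apply Hu.
    + rewrite (parallel_at_same (u X) X d); [apply parallel_at_on|].
      rewrite <- E at 1. apply Ht.
    + apply parallel_at_on.
    + apply parallel_at_on. }
assert (tran : ~ parallel d (join O (t (u O)))).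
{ intros H. apply HQ. rewrite <- uO.
  assert (K : O <> t (u O)).
  { intros K. apply HQ. rewrite <- uO. rewrite K at 2.
    rewrite (parallel_at_same (u O) (t (u O)) d); [apply parallel_at_on|].
    apply Ht. }
  destruct (join_on _ _ K) as [K1 K2].
  rewrite (parallel_at_unique O d _ K1 H).
  rewrite <- (parallel_at_unique (t (u O)) d _ K2 H).
  rewrite (parallel_at_same (u O) (t (u O)) d); [apply parallel_at_on|].
  apply Ht. }
apply (translation_eq d _ _ (u O) (translation_comp d s t Hs Ht)
  (translation_comp d t s Ht Hs)).
rewrite (translation_commute_transverse d _ s _ Hs Htu tran).
f_equal. symmetry. now apply (translation_commute_transverse d e s u).
Qed.

End Dilatations.

(** * Arithmetic on [OI] by means of dilatations *)

Section Arithmetic.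

Context {Pi : affine_plane} (O I : point Pi).
Hypothesis HD : desargues Pi.
Hypothesis HOI : O <> I.
Hypothesis H3 : three_on (join O I).
Implicit Types A B X : point Pi.

Let ell := join O I.

Let O_on : on O ell := join_on_l O I HOI.
Let I_on : on I ell := join_on_r O I HOI.

(** Auxiliary points exist, so a value common to all of them is the only one the description can
    return. *)
Lemma the_point_via (via : point Pi -> point Pi) X :
  (forall B1, ~ on B1 ell -> via B1 = X) ->
  the_point (fun S => forall B1, ~ on B1 ell -> via B1 = S) = X.
Proof.
intros H. destruct (off_line ell) as [B1 H1].
transitivity (via B1); [|now apply H]. symmetry. revert B1 H1.
apply (the_point_spec (fun S => forall B1, ~ on B1 ell -> via B1 = S)).
now exists X.
Qed.

(** The last step of both constructions, where [P1] is [s B1]. *)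
Lemma meet_image s B1 B : dilatation s -> ~ on B1 ell -> on B ell ->
  on (s B) ell -> meet (parallel_at (s B1) (join B B1)) ell = s B.
Proof.
intros Ds H1 HB HsB.
assert (N : B <> B1) by congruence. destruct (join_on B B1 N).
apply meet_eq; trivial.
- intros E. apply H1. rewrite <- (par_on_eq (join B B1) ell B); trivial.
  rewrite <- E. apply parallel_at_par.
- now apply Ds.
Qed.

Lemma translation_on s X : translation ell s -> on X ell -> on (s X) ell.
Proof.
intros [_ H] HX. rewrite <- (parallel_at_self X ell) by trivial. apply H.
Qed.

(** [P1] is [s B1]: it lies on the trace of [B1] and on the parallel to [join O B1] through
    [s O]. *)
Lemma add_translation s B :
  translation ell s -> on B ell -> add O I (s O) B = s B.
Proof.
intros Hs HB. apply (the_point_via (fun B1 => add_via O I B1 (s O) B)).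
intros B1 H1. unfold add_via. fold ell.
assert (N : O <> B1) by congruence. destruct (join_on O B1 N).
rewrite (meet_eq (s B1) (parallel_at B1 ell)).
- apply meet_image; auto using translation_on. apply Hs.
- intros E. apply parallel_at_eq_par in E. apply H1.
  now rewrite (par_on_eq ell (join O B1) O).
- apply Hs.
- now apply Hs.
Qed.

Lemma dilatation_on s X :
  dilatation s -> s O = O -> on X ell -> on (s X) ell.
Proof.
intros Ds E HX. rewrite <- (parallel_at_self O ell) by trivial.
rewrite <- E at 1. now apply Ds.
Qed.

(** [P1] is [s B1]: it lies on [join O B1], as [s] fixes [O], and on the parallel to [join I B1]
    through [s I]. *)
Lemma mul_dilatation s B :
  dilatation s -> s O = O -> on B ell -> mul O I (s I) B = s B.
Proof.
intros Ds E HB. apply (the_point_via (fun B1 => mul_via O I B1 (s I) B)).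
intros B1 H1. unfold mul_via. fold ell.
assert (NO : O <> B1) by congruence. destruct (join_on O B1 NO).
assert (NI : I <> B1) by congruence. destruct (join_on I B1 NI).
rewrite (meet_eq (s B1) (parallel_at (s I) (join I B1))).
- apply meet_image; auto using dilatation_on.
- intros K. apply H1. unfold ell. rewrite (join_eq O I (join O B1)); trivial.
  rewrite <- (par_on_eq (join I B1) (join O B1) B1); trivial.
  rewrite <- K. apply parallel_at_par.
- now apply Ds.
- rewrite <- (parallel_at_self O (join O B1)) by trivial.
  rewrite <- E at 1. now apply Ds.
Qed.

Lemma translation_to A B : on A ell -> on B ell ->
  exists s, translation ell s /\ s A = B.
Proof.
intros HA HB. apply (translation_exists ell); trivial.
now rewrite parallel_at_self.
Qed.

(* For A = O this is the constant map. *)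
Lemma dilatation_to A : on A ell -> exists s, dilatation s /\ s O = O /\ s I = A.
Proof.
intros HA. destruct (classic (A = O)) as [->|N].
- exists (fun _ => O). repeat split. intros X Y l _ _. apply parallel_at_on.
- apply (homothety_exists ell); auto.
Qed.

Lemma add_on A B : on A ell -> on B ell -> on (add O I A B) ell.
Proof.
intros HA HB. destruct (translation_to O A) as [s [Hs <-]]; trivial.
rewrite add_translation; auto using translation_on.
Qed.

Lemma add_comm A B : on A ell -> on B ell -> add O I A B = add O I B A.
Proof.
intros HA HB. destruct (translation_to O A) as [s [Hs Es]]; trivial.
destruct (translation_to O B) as [t [Ht Et]]; trivial.
rewrite <- Es at 1. rewrite <- Et at 2. rewrite !add_translation; trivial.
rewrite <- Es, <- Et. now apply (translation_commute ell ell).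
Qed.

(** With [A] as [s O] and [B] as [t O], both sides are [s (t C)]. *)
Lemma add_assoc A B C : on A ell -> on B ell -> on C ell ->
  add O I (add O I A B) C = add O I A (add O I B C).
Proof.
intros HA HB HC. destruct (translation_to O A) as [s [Hs <-]]; trivial.
destruct (translation_to O B) as [t [Ht <-]]; trivial.
rewrite !(add_translation s), (add_translation t);
  auto using translation_on, add_on.
rewrite (add_translation (fun X => s (t X)));
  auto using translation_comp.
Qed.

Lemma add_zero_r A : on A ell -> add O I A O = A.
Proof.
intros HA. destruct (translation_to O A) as [s [Hs <-]]; trivial.
now apply add_translation.
Qed.

Lemma opp_spec A : on A ell -> on (opp O I A) ell /\ add O I A (opp O I A) = O.
Proof.
intros HA.
set (S := fun X => on X (join O I) /\ add O I A X = O /\ add O I X A = O).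
enough (H : S (opp O I A)) by (unfold S in H; tauto).
change (S (the_point S)). apply the_point_spec. unfold S.
destruct (translation_to A O) as [s [Hs Es]]; trivial.
(* Taking [A] to [O], the translation [s] acts as addition of the opposite of [A], which is
   therefore [s O]. *)
exists (s O).
assert (E : add O I (s O) A = O) by (rewrite add_translation; trivial).
assert (on (s O) ell) by auto using translation_on.
repeat split; trivial. now rewrite add_comm.
Qed.

Lemma sub_on A B : on A ell -> on B ell -> on (sub O I A B) ell.
Proof. intros HA HB. apply add_on; trivial. now apply opp_spec. Qed.

Lemma sub_self A : on A ell -> sub O I A A = O.
Proof. apply opp_spec. Qed.

Lemma mul_on A B : on A ell -> on B ell -> on (mul O I A B) ell.
Proof.
intros HA HB. destruct (dilatation_to A) as [s [Ds [Es <-]]]; trivial.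
rewrite mul_dilatation; auto using dilatation_on.
Qed.

Lemma mul_zero_r A : on A ell -> mul O I A O = O.
Proof.
intros HA. destruct (dilatation_to A) as [s [Ds [Es <-]]]; trivial.
now rewrite mul_dilatation.
Qed.

Lemma mul_zero_l A : on A ell -> mul O I O A = O.
Proof.
(* The constant map is a dilatation fixing [O] and sending [I] to [O]. *)
intros HA. apply (mul_dilatation (fun _ => O)); trivial.
intros X Y l _ _. apply parallel_at_on.
Qed.

Lemma inv_on v A : on v ell -> on A ell -> on (inv O I v A) ell.
Proof.
intros Hv HA. unfold inv.
destruct (excluded_middle_informative (A = O)) as [|N]; trivial.
set (S := fun X => on X (join O I) /\ mul O I A X = I /\ mul O I X A = I).
enough (H : S (the_point S)) by apply H.
apply the_point_spec. unfold S.
destruct (dilatation_to A) as [s [Ds [sO sI]]]; trivial.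
(* [t] undoes [s], since their composite fixes [O] and [A]; so [t I] is inverse to [A] on both
   sides. *)
destruct (homothety_exists ell O A I) as [t [Dt [tO tA]]]; auto.
{ now rewrite (join_eq O A ell) by auto. }
assert (HtI : on (t I) ell) by auto using dilatation_on.
exists (t I). repeat split; trivial.
- rewrite <- sI, mul_dilatation; trivial.
  apply (dilatation_eq (fun X => s (t X)) (fun X => X) O A); auto.
  + now apply dilatation_comp.
  + intros X Y; apply pll_refl.
  + now rewrite tO.
  + now rewrite tA.
- now rewrite mul_dilatation.
Qed.

Lemma cross_ratio_on v A B C D : on v ell ->
  on A ell -> on B ell -> on C ell -> on D ell ->
  on (cross_ratio O I v A B C D) ell.
Proof.
intros. unfold cross_ratio. auto 8 using mul_on, inv_on, sub_on.
Qed.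

(** The factor [sub O I B B] is [O] and annihilates the product, whatever values the inverses take
    on the line. *)
Lemma cross_ratio_zero v A B C : on v ell ->
  on A ell -> on B ell -> on C ell -> cross_ratio O I v A B C B = O.
Proof.
intros. unfold cross_ratio.
rewrite (sub_self B) by trivial.
rewrite mul_zero_r by auto using inv_on, sub_on.
apply mul_zero_l. auto using mul_on, inv_on, sub_on.
Qed.

End Arithmetic.

Theorem theorem10 (Pi : affine_plane) (HD : desargues Pi)
    (O I : point Pi) (HOI : O <> I)
    (v : point Pi) (Hv : on v (join O I))
    (A B C : point Pi)
    (HA : on A (join O I)) (HB : on B (join O I)) (HC : on C (join O I))
    (HAB : A <> B) (HBC : B <> C) (HAC : A <> C)
    (HAO : A <> O) (HBO : B <> O) (HCO : C <> O) :
  let f (X : point Pi) := cross_ratio O I v A B C X in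
  (forall X Y Z : point Pi,
     on X (join O I) -> on Y (join O I) -> on Z (join O I) ->
     add O I (add O I (f X) (f Y)) (f Z) = add O I (f X) (add O I (f Y) (f Z)))
  /\
  (forall X Y : point Pi,
     on X (join O I) -> on Y (join O I) ->
     add O I (f X) (f Y) = add O I (f Y) (f X))
  /\
  (exists Z : point Pi, on Z (join O I) /\
     forall X : point Pi, on X (join O I) -> add O I (f X) (f Z) = f X).
Proof.
intros f.
(* The three fixed points exclude the plane of order two. *)
assert (H3 : three_on (join O I)).
{ exists A, B, C. tauto. }
assert (Hf : forall X, on X (join O I) -> on (f X) (join O I)).
{ intros X HX. now apply cross_ratio_on. }
split; [|split].
- intros X Y Z HX HY HZ. apply add_assoc; auto.
- intros X Y HX HY. apply add_comm; auto.
- exists B. split; trivial. intros X HX.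
  unfold f at 2. rewrite cross_ratio_zero by trivial.
  apply add_zero_r; auto.
Qed.
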